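(* Let $\mathbf{P}$ be a residuated partially ordered monoid and let $\mathbf{L}$ be a join-completion of $\mathbf{P}$ which is a residuated lattice with respect to a multiplication extending the multiplication of $\mathbf{P}$. Let $d\in P$ be a cyclic dualizing element of $\mathbf{P}$. Put $P_{\gamma_d}=\{(x\backslash_{\mathbf{P}} d)\backslash_{\mathbf{P}} d\mid x\in P\}$ and $L_{\gamma_d}=\{(x\backslash_{\mathbf{L}} d)\backslash_{\mathbf{L}} d\mid x\in L\}$, both with the order induced from $\mathbf{L}$. Then $\mathbf{L}_{\gamma_d}$ is the Dedekind–MacNeille completion of $\mathbf{P}_{\gamma_d}$; that is, $P_{\gamma_d}\subseteq L_{\gamma_d}$, $\mathbf{L}_{\gamma_d}$ is a complete lattice, and every element of $L_{\gamma_d}$ is both a join and a meet in $\mathbf{L}_{\gamma_d}$ of elements of $P_{\gamma_d}$.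
   Context: A residuated partially ordered monoid is a partially ordered monoid (multiplication order-preserving in each argument) in which the residuals $a\backslash b=\max\{x\mid ax\le b\}$ and $b/a=\max\{x\mid xa\le b\}$ always exist. A residuated lattice is a residuated partially ordered monoid whose order is a lattice. A join-completion of $\mathbf{P}$ is a complete lattice $\mathbf{L}$ with $P\subseteq L$, whose order restricts to that of $\mathbf{P}$, in which every element is a join of elements of $P$. An element $d$ of a residuated partially ordered monoid is cyclic if $d/x=x\backslash d$ for all $x$; writing $x\rightsquigarrow d$ for this common value, $d$ is cyclic dualizing if moreover $(x\rightsquigarrow d)\rightsquigarrow d=x$ for all $x$. *)

(* Defs.v *)
From HB Require Import structures.
From mathcomp Require Import all_boot all_order.
From mathcomp Require Import boolp classical_sets.

Set Implicit Arguments.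
Unset Strict Implicit.
Unset Printing Implicit Defensive.

Import Order.TTheory.

Local Open Scope classical_set_scope.
Local Open Scope order_scope.
Local Open Scope group_scope.

Definition is_max d (T : porderType d) (A : set T) (m : T) : Prop :=
  A m /\ ubound A m.

Definition is_min d (T : porderType d) (A : set T) (m : T) : Prop :=
  A m /\ lbound A m.

(* [lres a b] is the residual a \ b and [rres b a] is the residual b / a. *)
HB.mixin Record Monoid_isResiduated d T of Monoid T & Order.POrder d T := {
  lemul2 : forall a b x y : T, a <= b -> x <= y -> a * x <= b * y;
  lres : T -> T -> T;
  rres : T -> T -> T;
  lres_max : forall a b : T, is_max [set x : T | a * x <= b] (lres a b);
  rres_max : forall a b : T, is_max [set x : T | x * a <= b] (rres b a)
}.

#[short(type="residuatedPOMonoidType")]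
HB.structure Definition ResiduatedPOMonoid d :=
  { T of Monoid_isResiduated d T & Monoid T & Order.POrder d T }.

#[short(type="residuatedLatticeType")]
HB.structure Definition ResiduatedLattice d :=
  { T of ResiduatedPOMonoid d T & Order.Lattice d T }.

Definition cyclic_elt disp (T : residuatedPOMonoidType disp) (d : T) : Prop :=
  forall x : T, rres d x = lres x d.

Definition cyclic_dualizing disp (T : residuatedPOMonoidType disp) (d : T) :
    Prop :=
  cyclic_elt d /\ forall x : T, lres (lres x d) d = x.

(* A subset S of a poset T stands for the poset S with the order induced from
   T; joins and meets in S are relative to S and may differ from those in T. *)
Section Subposets.
Context {disp : Order.disp_t} {T : porderType disp}.
Implicit Types (S Q A : set T) (x : T).

Definition join_in S A x : Prop := is_min (S `&` ubound A) x.

Definition meet_in S A x : Prop := is_max (S `&` lbound A) x.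

Definition complete_lattice_in S : Prop :=
  forall A, A `<=` S -> (exists x, join_in S A x) /\ (exists x, meet_in S A x).

Definition join_dense_in S Q : Prop :=
  forall x, S x -> exists2 A, A `<=` Q & join_in S A x.

Definition meet_dense_in S Q : Prop :=
  forall x, S x -> exists2 A, A `<=` Q & meet_in S A x.

Definition dedekind_macneille_in S Q : Prop :=
  [/\ Q `<=` S, complete_lattice_in S, join_dense_in S Q & meet_dense_in S Q].

End Subposets.

(* The inclusion of P in L is represented by an order embedding e, along which
   P is identified with its image. *)
Definition join_completion dP dL (P : porderType dP) (L : porderType dL)
    (e : P -> L) : Prop :=
  [/\ {mono e : x y / x <= y}, complete_lattice_in [set: L]
    & join_dense_in [set: L] (range e)].

Definition gamma_image disp (T : residuatedPOMonoidType disp) (d : T) : set T :=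
  [set lres (lres x d) d | x in [set: T]].

(* Main.v *)
Require Import Defs.
From mathcomp Require Import all_boot all_order.
From mathcomp Require Import boolp classical_sets.

(** Since multiplication in L distributes over joins and P is join-dense in L,
    the embedding preserves residuals and d stays cyclic in L. Hence
    x |-> x \ d is an antitone Galois connection of L with itself, and the image
    of its square is a complete lattice which contains P, as d is dualizing in
    P. Join-density is inherited from L; if x = y \ d and y is the join of the
    p's in P below it, then x is the meet of the p \ d, all of which are in P. *)

Import Order.TTheory.

Local Open Scope classical_set_scope.
Local Open Scope order_scope.
Local Open Scope group_scope.

Section Residuation.
Context {disp : Order.disp_t} {T : residuatedPOMonoidType disp}.
Implicit Types a b c x y : T.

Lemma le_lres a b x : (x <= lres a b) = (a * x <= b).
Proof.
have [ab ub] := lres_max a b; apply/idP/idP; last exact: ub.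
by move=> xab; apply: le_trans ab; apply: lemul2.
Qed.

Lemma le_rres a b x : (x <= rres b a) = (x * a <= b).
Proof.
have [ab ub] := rres_max a b; apply/idP/idP; last exact: ub.
by move=> xab; apply: le_trans ab; apply: lemul2.
Qed.

(** Free of residuals, this form of cyclicity can be checked on products of elements of P. *)
Lemma cyclic_eltP c : (forall x y, (x * y <= c) = (y * x <= c)) <-> cyclic_elt c.
Proof.
split=> [cC x | cC x y]; last by rewrite -le_lres -cC le_rres.
by apply/eqP; rewrite eq_le le_lres -cC -le_rres lexx le_rres cC -le_lres lexx.
Qed.

Lemma lres_galois c : cyclic_elt c ->
  forall x y, (x <= lres y c) = (y <= lres x c).
Proof. by move=> /cyclic_eltP cC x y; rewrite !le_lres cC. Qed.

End Residuation.

(** Carries joins in L over to the closed elements, whence their join-density. *)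
Lemma join_in_sub disp (T : porderType disp) (S S' A : set T) (x : T) :
  S' `<=` S -> S' x -> join_in S A x -> join_in S' A x.
Proof.
move=> sub Sx [[_ Ax] minx]; split=> // y [Sy Ay].
by apply: minx; split=> //; apply: sub.
Qed.

Section AntitoneGalois.
Context {disp : Order.disp_t} {T : porderType disp} {f : T -> T}.
Hypothesis galois : forall x y, (x <= f y) = (y <= f x).

Lemma galois_ge x : x <= f (f x).
Proof. by rewrite galois. Qed.

Lemma galois_anti x y : x <= y -> f y <= f x.
Proof. by move=> xy; rewrite galois (le_trans xy) ?galois_ge. Qed.

Lemma galois3 x : f (f (f x)) = f x.
Proof. by apply/eqP; rewrite eq_le galois_ge galois_anti ?galois_ge. Qed.

Let closed := [set f (f x) | x in [set: T]].

Lemma galois_closedK x : closed x -> f (f x) = x.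
Proof. by case=> y _ <-; rewrite galois3. Qed.

Lemma galois_closed x : closed (f x).
Proof. by exists (f x); rewrite ?galois3. Qed.

(** The map [f \o f] is a closure operator: a closed [y] above [A] is above [x], so [y = f (f y)] is
    above [f (f x)]. *)
Lemma galois_join_closed (A : set T) x :
  join_in [set: T] A x -> join_in closed A (f (f x)).
Proof.
move=> [[_ Ax] minx]; split.
  split=> [|y Ay]; first exact: galois_closed.
  by apply: le_trans (galois_ge x); apply: Ax.
move=> y [ycl Ay]; rewrite -(galois_closedK _ ycl).
by do 2 apply: galois_anti; apply: minx.
Qed.

(** As [f \o f] is monotone and fixes each element of [A], [f (f x)] is again a lower bound of [A],
    hence below [x]. *)
Lemma galois_meet_closed (A : set T) x : A `<=` closed ->
  meet_in [set: T] A x -> meet_in closed A x.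
Proof.
move=> Acl [[_ Ax] maxx]; split; last by move=> y [_ Ay]; apply: maxx.
split=> //; suff <- : f (f x) = x by exact: galois_closed.
apply/eqP; rewrite eq_le galois_ge andbT; apply: maxx; split=> // y Ay.
by rewrite -(galois_closedK _ (Acl _ Ay)); do 2 apply: galois_anti; apply: Ax.
Qed.

Lemma galois_closed_complete :
  complete_lattice_in [set: T] -> complete_lattice_in closed.
Proof.
move=> cT A Acl; have [[x jx] [y my]] := cT A (fun _ _ => I).
split; first by exists (f (f x)); apply: galois_join_closed.
by exists y; apply: galois_meet_closed.
Qed.

(** [z] is below every [f y] iff every [y] is below [f z], iff [x <= f z], iff [z <= f x]. *)
Lemma galois_join_to_meet (A : set T) x :
  join_in [set: T] A x -> meet_in closed (f @` A) (f x).
Proof.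
move=> [[_ Ax] minx]; split.
  split=> [|_ [y Ay <-]]; first exact: galois_closed.
  exact/galois_anti/Ax.
move=> z [_ zA]; rewrite galois; apply: minx; split=> // y Ay.
by rewrite galois; apply: zA; exists y.
Qed.

End AntitoneGalois.

Section JoinCompletion.
Context {dP dL : Order.disp_t} {P : residuatedPOMonoidType dP}
  {L : residuatedPOMonoidType dL} {e : P -> L}.
Hypotheses (e_mono : {mono e : x y / x <= y})
  (e_dense : join_dense_in [set: L] (range e)) (eM : {morph e : x y / x * y}).

Lemma join_dense_le (x y : L) : (forall p, e p <= x -> e p <= y) -> x <= y.
Proof.
have [A Ae [[_ Ax] minx]] := e_dense x I => xy.
apply: minx; split=> // z Az; have [p _ ep] := Ae z Az.
by rewrite -ep; apply: xy; rewrite ep; apply: Ax.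
Qed.

Lemma lres_embed a b : lres (e a) (e b) = e (lres a b).
Proof.
apply/eqP; rewrite eq_le le_lres -eM e_mono -le_lres lexx andbT.
by apply: join_dense_le => p; rewrite le_lres -eM !e_mono le_lres.
Qed.

(** Residuation isolates first [x], then [y], on the left of an inequality, where join-density
    replaces it by an element of P below it; cyclicity in P then swaps the two. *)
Lemma cyclic_embed d : cyclic_elt d -> cyclic_elt (e d).
Proof.
move=> /cyclic_eltP dC; apply/cyclic_eltP.
suff le x y : x * y <= e d -> y * x <= e d.
  by move=> x y; apply/idP/idP; apply: le.
move=> xyd; rewrite -le_lres; apply: join_dense_le => p px.
rewrite le_lres -le_rres; apply: join_dense_le => q qy.
rewrite le_rres -eM e_mono dC -(e_mono (p * q)) eM.
by apply: le_trans xyd; apply: lemul2.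
Qed.

End JoinCompletion.

Lemma gamma_image_dualizing disp (T : residuatedPOMonoidType disp) (d : T) :
  cyclic_dualizing d -> gamma_image d = [set: T].
Proof. by case=> _ dK; apply/seteqP; split=> // x _; exists x. Qed.

Theorem theorem4p4 (dP dL : Order.disp_t)
    (P : residuatedPOMonoidType dP) (L : residuatedLatticeType dL)
    (e : P -> L) (d : P)
    (he : join_completion e)
    (hM : {morph e : x y / x * y})
    (hd : cyclic_dualizing d) :
  dedekind_macneille_in (gamma_image (e d)) (e @` gamma_image d).
Proof.
(* Since [d] is dualizing, the candidate dense subset is all of [range e]. *)
rewrite (gamma_image_dualizing _ _ _ hd).
case: he hd => e_mono cL e_dense [dC dK].
(* For [f x := lres x (e d)], the set [closed] of the Galois lemmas is [gamma_image (e d)] by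
   conversion. *)
have galois := lres_galois _ (cyclic_embed e_mono e_dense hM _ dC).
split.
- move=> _ [p _ <-]; exists (e p) => //.
  by rewrite !(lres_embed e_mono e_dense hM) dK.
- exact: galois_closed_complete galois cL.
- move=> x Sx; have [A Ae Ax] := e_dense x I.
  by exists A => //; apply: join_in_sub Ax.
(* A closed [x] is [y \ d] for [y = x \ d], so it is this [y] that is written as a join. *)
- move=> x Sx; have [A Ae Ax] := e_dense (lres x (e d)) I.
  exists [set lres y (e d) | y in A].
    move=> _ [y /Ae[p _ <-] <-]; exists (lres p d) => //.
    by rewrite (lres_embed e_mono e_dense hM).
  by rewrite -[x in meet_in _ _ x](galois_closedK galois _ Sx); apply: galois_join_to_meet.
Qed.
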